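(* The problem Weighted DTW-Mean is solvable with $O(n^{2k+1}2^k k)$ arithmetical operations, where $k$ is the number of input time series and $n$ is the maximum length of any input time series. That is, there is an algorithm which, given univariate rational time series $x^{(1)},\ldots,x^{(k)}$ of maximum length $n$ and rational nonnegative weights $w_1,\ldots,w_k$, outputs, using $O(n^{2k+1}2^kk)$ arithmetical operations, a univariate rational time series $z\in\mathcal{T}$ that minimizes $F_w(z)=\sum_{i=1}^k w_i\,\mathrm{dtw}(z,x^{(i)})^2$ over all of $\mathcal{T}$ (with no restriction on the length of $z$).
   Context: A univariate rational time series of length $n\ge 1$ is a sequence $x=(x_1,\ldots,x_n)\in\mathbb{Q}^n$; $\mathcal{T}_n$ is the set of all those of length $n$, and $\mathcal{T}=\bigcup_{n\in\mathbb{N}}\mathcal{T}_n$. Write $[n]=\{1,\ldots,n\}$. A warping path of order $m\times n$ is a sequence $p=(p_1,\ldots,p_L)$ with $p_\ell\in[m]\times[n]$ such that $p_1=(1,1)$, $p_L=(m,n)$, and $p_{\ell+1}-p_\ell\in\{(1,0),(0,1),(1,1)\}$ for all $\ell\in[L-1]$. The set of all of them is $\mathcal{P}_{m,n}$. For time series $x$ of length $m$ and $y$ of length $n$ and $p=((i_1,j_1),\ldots,(i_L,j_L))\in\mathcal{P}_{m,n}$, the cost is $C_p(x,y)=\sum_{\ell=1}^L(x_{i_\ell}-y_{j_\ell})^2$, and the dtw-distance is $\mathrm{dtw}(x,y)=\min_{p\in\mathcal{P}_{m,n}}\sqrt{C_p(x,y)}$. Weighted DTW-Mean. Input: a sample of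 $k$ univariate rational time series $x^{(1)},\ldots,x^{(k)}$ and rational nonnegative weights $w_1,\ldots,w_k$. Task: find a univariate rational time series $z$ that minimizes the weighted Fréchet function $F_w(z)=\sum_{i=1}^k w_i\,\mathrm{dtw}(z,x^{(i)})^2$. Running time is measured as the number of arithmetical operations (including comparisons and table look-ups) on rational numbers. *)

(* Defs.v *)
From HB Require Import structures.
From mathcomp Require Import all_boot all_order all_algebra.
From mathcomp Require Import classical_sets reals.

Set Implicit Arguments.
Unset Strict Implicit.
Unset Printing Implicit Defensive.

Import Order.TTheory GRing.Theory Num.Theory.
Local Open Scope ring_scope.

(* Time series are sequences s : seq rat with 0 < size s.  Positions are counted
   from 0, so a warping path of order m x n runs from (0, 0) to (m-1, n-1). *)

Definition wstep : rel (nat * nat) := fun c d =>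
  d \in [:: (c.1.+1, c.2); (c.1, c.2.+1); (c.1.+1, c.2.+1)].

Definition warping_path (m n : nat) (p : seq (nat * nat)) : bool :=
  [&& p != [::],
      all (fun c => (c.1 < m)%N && (c.2 < n)%N) p,
      head (0, 0)%N p == (0, 0)%N,
      last (0, 0)%N p == (m.-1, n.-1)
    & sorted wstep p].

Definition path_cost (x y : seq rat) (p : seq (nat * nat)) : rat :=
  \sum_(c <- p) (x`_c.1 - y`_c.2) ^+ 2.

(* There are finitely many warping paths, and at least one when x and y are
   nonempty, so this infimum is a minimum: see dtw_min below. *)
Definition dtw (R : realType) (x y : seq rat) : R :=
  inf [set Num.sqrt (ratr (path_cost x y p) : R)
      | p in [set p | warping_path (size x) (size y) p]].

Definition frechet (R : realType) (k : nat)
    (x : k.-tuple (seq rat)) (w : k.-tuple rat) (z : seq rat) : R :=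
  \sum_(i < k) ratr (tnth w i) * dtw R z (tnth x i) ^+ 2.

Definition is_weighted_dtw_mean (R : realType) (k : nat)
    (x : k.-tuple (seq rat)) (w : k.-tuple rat) (z : seq rat) : Prop :=
  (0 < size z)%N /\
  forall z' : seq rat, (0 < size z')%N -> frechet R x w z <= frechet R x w z'.

(* Algorithms are programs for a random access machine over the rationals.  A
   program is a finite text that refers to finitely many arrays, each named by a
   numeral: index arrays with entries in nat, used for lengths, loop counters and
   addresses, and data arrays with entries in rat.  All arrays are unbounded and
   zero outside the input.  Every operation has cost one, on rationals as well as
   on indices: constants, look-ups, arithmetic, comparisons, Boolean connectives,
   assignments and branchings. *)

Inductive iexp : Type :=
| IConst of nat
| IGet of nat & iexp        (* name of the index array, position *)
| IAdd of iexp & iexp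
| ISub of iexp & iexp       (* truncated subtraction *)
| IMul of iexp & iexp.

Inductive qexp : Type :=
| QConst of rat
| QGet of nat & iexp        (* name of the data array, position *)
| QAdd of qexp & qexp
| QSub of qexp & qexp
| QMul of qexp & qexp
| QDiv of qexp & qexp.      (* q / 0 evaluates to 0 *)

Inductive bexp : Type :=
| BILe of iexp & iexp
| BQLe of qexp & qexp
| BNot of bexp
| BAnd of bexp & bexp.

Inductive cmd : Type :=
| CSkip
| CISet of nat & iexp & iexp   (* array, position, new value *)
| CQSet of nat & iexp & qexp   (* array, position, new value *)
| CSeq of cmd & cmd
| CIf of bexp & cmd & cmd
| CWhile of bexp & cmd.

Record store : Type := Store {
  imem : nat -> nat -> nat;
  qmem : nat -> nat -> rat
}.

Definition upd (T : Type) (m : nat -> nat -> T) (a i : nat) (v : T) :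
    nat -> nat -> T :=
  fun b j => if (b == a) && (j == i) then v else m b j.

Fixpoint ieval (s : store) (e : iexp) : nat :=
  match e with
  | IConst n => n
  | IGet a e1 => imem s a (ieval s e1)
  | IAdd e1 e2 => ieval s e1 + ieval s e2
  | ISub e1 e2 => ieval s e1 - ieval s e2
  | IMul e1 e2 => ieval s e1 * ieval s e2
  end%N.

Fixpoint qeval (s : store) (e : qexp) : rat :=
  match e with
  | QConst q => q
  | QGet a e1 => qmem s a (ieval s e1)
  | QAdd e1 e2 => qeval s e1 + qeval s e2
  | QSub e1 e2 => qeval s e1 - qeval s e2
  | QMul e1 e2 => qeval s e1 * qeval s e2
  | QDiv e1 e2 => qeval s e1 / qeval s e2
  end.

Fixpoint beval (s : store) (b : bexp) : bool :=
  match b with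
  | BILe e1 e2 => (ieval s e1 <= ieval s e2)%N
  | BQLe e1 e2 => qeval s e1 <= qeval s e2
  | BNot b1 => ~~ beval s b1
  | BAnd b1 b2 => beval s b1 && beval s b2
  end.

Fixpoint icost (e : iexp) : nat :=
  match e with
  | IConst _ => 1
  | IGet _ e1 => (icost e1).+1
  | IAdd e1 e2 | ISub e1 e2 | IMul e1 e2 => (icost e1 + icost e2).+1
  end%N.

Fixpoint qcost (e : qexp) : nat :=
  match e with
  | QConst _ => 1
  | QGet _ e1 => (icost e1).+1
  | QAdd e1 e2 | QSub e1 e2 | QMul e1 e2 | QDiv e1 e2 =>
      (qcost e1 + qcost e2).+1
  end%N.

Fixpoint bcost (b : bexp) : nat :=
  match b with
  | BILe e1 e2 => (icost e1 + icost e2).+1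
  | BQLe e1 e2 => (qcost e1 + qcost e2).+1
  | BNot b1 => (bcost b1).+1
  | BAnd b1 b2 => (bcost b1 + bcost b2).+1
  end%N.

(* exec c s s' t: started in s, c halts in s' after t operations. *)
Inductive exec : cmd -> store -> store -> nat -> Prop :=
| exec_skip s : exec CSkip s s 1
| exec_iset a e v s :
    exec (CISet a e v) s
      (Store (upd (imem s) a (ieval s e) (ieval s v)) (qmem s))
      (icost e + icost v).+1
| exec_qset a e v s :
    exec (CQSet a e v) s
      (Store (imem s) (upd (qmem s) a (ieval s e) (qeval s v)))
      (icost e + qcost v).+1
| exec_seq c1 c2 s s1 s2 t1 t2 :
    exec c1 s s1 t1 -> exec c2 s1 s2 t2 ->
    exec (CSeq c1 c2) s s2 (t1 + t2)
| exec_if_true b c1 c2 s s' t :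
    beval s b -> exec c1 s s' t ->
    exec (CIf b c1 c2) s s' (bcost b + t).+1
| exec_if_false b c1 c2 s s' t :
    ~~ beval s b -> exec c2 s s' t ->
    exec (CIf b c1 c2) s s' (bcost b + t).+1
| exec_while_false b c s :
    ~~ beval s b -> exec (CWhile b c) s s (bcost b).+1
| exec_while_true b c s s1 s2 t1 t2 :
    beval s b -> exec c s s1 t1 -> exec (CWhile b c) s1 s2 t2 ->
    exec (CWhile b c) s s2 (bcost b + t1 + t2).+1.

(* Input: k in cell 0 of index array 0, the lengths of the series in index array 1,
   the weights in data array 0, the concatenation of the series in data array 1. *)
Definition input (k : nat) (x : k.-tuple (seq rat)) (w : k.-tuple rat) : store :=
  Store
    (fun a i => match a with
                | 0 => if i == 0 then k else 0
                | 1 => nth 0 (map size x) i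
                | _ => 0
                end)%N
    (fun a i => match a with
                | 0 => w`_i
                | 1 => (flatten x)`_i
                | _ => 0
                end).

(* Output: the length in cell 0 of index array 2, the entries in data array 2. *)
Definition output (s : store) : seq rat := mkseq (qmem s 2) (imem s 2 0).

Lemma exec_det c s s1 s2 t1 t2 :
  exec c s s1 t1 -> exec c s s2 t2 -> s1 = s2 /\ t1 = t2.
Proof.
move=> H; elim: H s2 t2 => {c s s1 t1}.
- by move=> s s2 t2 H; inversion H.
- by move=> a e v s s2 t2 H; inversion H.
- by move=> a e v s s2 t2 H; inversion H.
- move=> c1 c2 s s1 s2 t1 t2 _ IH1 _ IH2 s3 t3 H; inversion H; subst.
  match goal with h : exec c1 _ _ _ |- _ => case: (IH1 _ _ h) => ? ? end; subst.
  by match goal with h : exec c2 _ _ _ |- _ => case: (IH2 _ _ h) => -> -> end.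
- move=> b c1 c2 s s' t bT _ IH s3 t3 H; inversion H; subst.
    by match goal with h : exec c1 _ _ _ |- _ => case: (IH _ _ h) => -> -> end.
  by match goal with h : is_true (~~ _) |- _ => rewrite bT in h end.
- move=> b c1 c2 s s' t bF _ IH s3 t3 H; inversion H; subst.
    by match goal with h : is_true (beval _ _) |- _ => rewrite h in bF end.
  by match goal with h : exec c2 _ _ _ |- _ => case: (IH _ _ h) => -> -> end.
- move=> b c s bF s3 t3 H; inversion H; subst=> //.
  by match goal with h : is_true (beval _ _) |- _ => rewrite h in bF end.
- move=> b c s s1 s2 t1 t2 bT _ IH1 _ IH2 s3 t3 H; inversion H; subst.
    by match goal with h : is_true (~~ _) |- _ => rewrite bT in h end.
  match goal with h : exec c _ _ _ |- _ => case: (IH1 _ _ h) => ? ? end; subst.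
  by match goal with h : exec (CWhile _ _) _ _ _ |- _ => case: (IH2 _ _ h) => -> -> end.
Qed.

Lemma warping_path_exists m n : (0 < m)%N -> (0 < n)%N ->
  exists p, warping_path m n p.
Proof.
case: m n => [//|m] [//|n] _ _.
suff [p [h1 h2 h3]] : exists p : seq (nat * nat),
    [/\ path wstep (0, 0)%N p, last (0, 0)%N p = (m, n)
      & all (fun c => (c.1 <= m)%N && (c.2 <= n)%N) p].
  exists ((0, 0)%N :: p).
  by rewrite /warping_path /= h1 h2 !eqxx !andbT.
elim: n => [|n [p [h1 h2 h3]]].
  elim: m => [|m [p [h1 h2 h3]]]; first by exists [::].
  exists (rcons p (m.+1, 0)%N); split.
  - by rewrite rcons_path h1 h2 /wstep /= !inE eqxx.
  - by rewrite last_rcons.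
  - rewrite all_rcons /= leqnn /=; apply: sub_all h3 => c /andP[a ->].
    by rewrite (leq_trans a).
exists (rcons p (m, n.+1)%N); split.
- by rewrite rcons_path h1 h2 /wstep /= !inE eqxx orbT.
- by rewrite last_rcons.
- rewrite all_rcons /= !leqnn /=; apply: sub_all h3 => c /andP[-> a].
  by rewrite (leq_trans a).
Qed.

Lemma warping_path_size m n p : warping_path m n p -> (size p <= m + n)%N.
Proof.
case: p => [|c p] // /and5P[_ /= /andP[/andP[c1 c2] hall] /eqP hc /eqP hl hp].
have hs : (size p + (c.1 + c.2) <= (last c p).1 + (last c p).2)%N.
  elim: p c hp {hall hl hc c1 c2} => [|d p IH] c //= /andP[hcd hp].
  apply: leq_trans (IH _ hp); rewrite addSn -addnS leq_add2l.
  by move: hcd; rewrite /wstep !inE => /or3P[] /eqP -> /=;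
    rewrite ?addSn ?addnS ?ltnS ?leqnSn.
move: hs; rewrite hl hc /= !addn0 => hs.
by rewrite -(prednK (leq_ltn_trans (leq0n _) c1)) addSn ltnS (leq_trans hs) //
  leq_add2l leq_pred.
Qed.

Lemma dtw_min (R : realType) (x y : seq rat) :
  (0 < size x)%N -> (0 < size y)%N ->
  exists p, [/\ warping_path (size x) (size y) p,
    dtw R x y = Num.sqrt (ratr (path_cost x y p))
    & forall q, warping_path (size x) (size y) q ->
        Num.sqrt (ratr (path_cost x y p) : R)
          <= Num.sqrt (ratr (path_cost x y q))].
Proof.
move=> x0 y0; set f := fun p => Num.sqrt (ratr (path_cost x y p) : R).
set m := size x in x0 *; set n := size y in y0 *.
pose T := (m + n).-bseq ('I_m * 'I_n)%type.
pose g (u : T) : seq (nat * nat) := [seq (val c.1, val c.2) | c <- u].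
have gP p : warping_path m n p -> exists u : T, g u = p.
  move=> hp; have hs := warping_path_size hp.
  have hall : all (fun c => (c.1 < m)%N && (c.2 < n)%N) p by case/and5P: hp.
  have [v hv] : exists v : seq ('I_m * 'I_n), [seq (val c.1, val c.2) | c <- v] = p.
    elim: p hall {hp hs} => [|c p IH] /=; first by exists [::].
    case/andP=> /andP[c1 c2] /IH[v <-].
    by exists ((Ordinal c1, Ordinal c2) :: v) => /=; case: c {c1 c2}.
  have hv' : (size v <= m + n)%N by rewrite -(size_map (fun c => (val c.1, val c.2))) hv.
  by exists (Bseq hv').
have [p0 /[dup] hp0 /gP[u0 hu0]] := warping_path_exists x0 y0.
have Pu0 : warping_path m n (g u0) by rewrite hu0.
case: (@arg_minP _ R _ u0 (fun u => warping_path m n (g u)) (f \o g) Pu0) => u Pu minu.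
have minp q : warping_path m n q -> f (g u) <= f q.
  by move=> /[dup] hq /gP[v hv]; move: (minu v); rewrite hv /= hv; apply.
exists (g u); split => //; apply/eqP; rewrite eq_le; apply/andP; split.
  apply: ge_inf; last by exists (g u).
  by exists (f (g u)) => _ [q hq <-]; exact: minp.
apply: lb_le_inf; first by exists (f (g u)), (g u).
by move=> _ [q hq <-]; exact: minp.
Qed.

(* Main.v *)
(* The first t entries of a mean candidate z consume a prefix of every input
   series.  Between two consecutive prefix vectors e <= q, one entry v of z is
   matched in series j to a block of positions ending at q_j; a cheapest block
   starts right after e_j if e_j < q_j, and is the single position q_j if
   e_j = q_j.  So the block is determined by e_j and q_j, and no minimum over the
   2^k ways of overlapping consecutive blocks is needed.  The best v is the
   weighted mean of the entries in the blocks, its cost is S_2 - S_1^2 / S_0 in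
   terms of the weighted moments S_0, S_1, S_2, and an entry of z that consumes
   nothing new only adds a nonnegative cost.  Hence the minimum of F_w is the
   length of a shortest path in an acyclic graph on at most n^k + 1 prefix vectors,
   computed backwards in a lexicographic order that refines the componentwise one,
   with O(n k) operations for each of the at most n^(2k) pairs. *)

Require Import Defs.
From mathcomp Require Import all_boot all_order all_algebra.
From mathcomp Require Import reals.
From mathcomp Require Import zify ring.

Set Implicit Arguments.
Unset Strict Implicit.
Unset Printing Implicit Defensive.

Import Order.TTheory GRing.Theory Num.Theory.
Local Open Scope ring_scope.

(** * Warping paths and block ends *)

(** First position, counted from 0, of the block of an entry that raises the number of consumed
    positions from [a] to [b]: it is [a] if [a < b], and the last consumed position [b.-1] if
    [a = b]. *)
Definition lo (a b : nat) : nat := minn a b.-1.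

Definition block_cost (x : seq rat) (a b : nat) (v : rat) : rat :=
  \sum_(lo a b <= p < b) (v - x`_p) ^+ 2.

(* [B t] is the number of entries of a series of length [n] that are matched by
   the first [t] entries of a series of length [m]. *)
Definition is_ends (m n : nat) (B : nat -> nat) : Prop :=
  [/\ B 0 = 0, B m = n & forall t, t < m -> B t <= B t.+1 /\ 0 < B t.+1]%N.

Lemma ends_le m n B : is_ends m n B ->
  forall t u, (t <= u)%N -> (u <= m)%N -> (B t <= B u)%N.
Proof.
move=> [_ _ Bs] t u; elim: u => [|u IH]; first by rewrite leqn0 => /eqP->.
rewrite leq_eqVlt => /predU1P[-> //|]; rewrite ltnS => tu um.
by apply: leq_trans (IH tu (ltnW um)) _; have [] := Bs _ um.
Qed.

Lemma block_cost_ge0 x a b v : 0 <= block_cost x a b v.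
Proof. by apply: sumr_ge0 => p _; exact: sqr_ge0. Qed.

(** Induction on the path from its first cell [(i, j)]. Row [i] may start anywhere, so its cost is
    kept apart as a sum from [j]. Only the values of [B] beyond [i] matter, which leaves [B i.+1]
    free to be redefined when a row is put in front. *)
Lemma path_ends_from (z x : seq rat) m n i j p :
  path wstep (i, j) p -> last (i, j) p = (m, n) ->
  exists B, [/\ (i <= m)%N, B m.+1 = n.+1, (j < B i.+1)%N,
    forall t, (i < t <= m)%N -> (B t <= B t.+1)%N
    & \sum_(j <= q < B i.+1) (z`_i - x`_q) ^+ 2
      + \sum_(i.+1 <= t < m.+1) block_cost x (B t) (B t.+1) z`_t
      <= path_cost z x ((i, j) :: p)].
Proof.
elim: p i j => [|c p IH] i j.
  move=> _ [-> ->]; exists (fun=> n.+1); split => //.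
  by rewrite /path_cost big_seq1 big_nat1 big_geq ?addr0.
rewrite /path_cost big_cons /= /wstep !inE => /andP[/or3P[] /eqP ->] /= hp hl.
- have [B [im Bm jB Bs hB]] := IH _ _ hp hl.
  exists (fun t => if t == i.+1 then j.+1 else B t); split.
  + exact: ltnW.
  + by rewrite eqSS gtn_eqF.
  + by rewrite eqxx.
  + move=> t /andP[it tm]; rewrite eqSS (gtn_eqF it).
    by case: eqP it => [->|/eqP ti] it //; apply: Bs; lia.
  + rewrite eqxx big_nat1 lerD2l big_ltn ?ltnS // eqxx eqSS gtn_eqF //.
    apply: le_trans hB; rewrite lerD //; last first.
      rewrite big_nat [leRHS]big_nat; apply: ler_sum => t /andP[it tm].
      by rewrite eqSS !gtn_eqF // ltnW.
    (* After a step [(1, 0)] the next row starts at [j], which is already consumed. If that row goes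
       on past [j], its block starts at [j.+1] and the cost at [j] is dropped; this is the only loss
       in the inequality. *)
    rewrite /block_cost; have /orP[/eqP e|e] : (B i.+2 == j.+1) || (j.+1 < B i.+2)%N.
    * by lia.
    * by rewrite e /lo (minn_idPr _) ?leqnSn.
    * rewrite /lo (minn_idPl _); last by lia.
      by rewrite [leRHS]big_ltn ?lerDr ?sqr_ge0 // (leq_trans _ e).
- have [B [im Bm jB Bs hB]] := IH _ _ hp hl.
  exists B; split => //; first exact: ltnW.
  by rewrite big_ltn 1?ltnW //= -addrA lerD2l.
- have [B [im Bm jB Bs hB]] := IH _ _ hp hl.
  exists (fun t => if t == i.+1 then j.+1 else B t); split.
  + exact: ltnW.
  + by rewrite eqSS gtn_eqF.
  + by rewrite eqxx.
  + move=> t /andP[it tm]; rewrite eqSS (gtn_eqF it).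
    by case: eqP it => [->|/eqP ti] it; [exact: ltnW|apply: Bs; lia].
  + rewrite eqxx big_nat1 lerD2l big_ltn ?ltnS // eqxx eqSS gtn_eqF //.
    apply: le_trans hB; rewrite lerD //; last first.
      rewrite big_nat [leRHS]big_nat; apply: ler_sum => t /andP[it tm].
      by rewrite eqSS !gtn_eqF // ltnW.
    by rewrite /block_cost /lo (minn_idPl _) //; lia.
Qed.

Lemma path_ends (z x : seq rat) p : warping_path (size z) (size x) p ->
  exists2 B, is_ends (size z) (size x) B
    & \sum_(0 <= t < size z) block_cost x (B t) (B t.+1) z`_t <= path_cost z x p.
Proof.
case: p => [|c p] // /and5P[_ /= /andP[/andP[z0 x0] _] /eqP c0 /eqP hl hp].
rewrite c0 /= in z0 x0 hl hp *.
have [B [_ Bm B0 Bs hB]] := path_ends_from z x hp hl.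
(* [B] is constrained only from index 1 on. Index 0 is set to the empty prefix, and [lo 0 b = 0]
   lets the first row start at position 0. *)
rewrite !prednK // in Bm; exists (fun t => if t is 0 then 0%N else B t).
  split => //; first by case: (size z) z0 Bm.
  have Bpos t : (t < size z)%N -> (0 < B t.+1)%N.
    by elim: t => // t IH tz; apply: leq_trans (IH (ltnW tz)) (Bs _ _); lia.
  by case=> [|t] tz; split; rewrite ?Bpos // Bs //; lia.
rewrite prednK // in hB; apply: le_trans hB; rewrite big_ltn // lerD //.
  by rewrite /block_cost /lo min0n.
by rewrite big_nat [leRHS]big_nat; apply: ler_sum => -[].
Qed.

Lemma path_row i a b :
  path wstep (i, a) [seq (i, q) | q <- index_iota a.+1 b].
Proof.
rewrite /index_iota; move: (b - a.+1)%N => l; elim: l a => //= l IH a.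
by rewrite /wstep !inE eqxx orbT IH.
Qed.

(** Converse of [path_ends]: the rows from [lo (B t) (B t.+1)] to [(B t.+1).-1], put end to end,
    form a path whose cost is exactly the sum of the block costs. *)
Lemma ends_path (z x : seq rat) B : (0 < size z)%N ->
  is_ends (size z) (size x) B ->
  exists2 p, warping_path (size z) (size x) p
    & path_cost z x p = \sum_(0 <= t < size z) block_cost x (B t) (B t.+1) z`_t.
Proof.
move=> z0 hB; have Ble := ends_le hB; case: hB => B0 Bm Bs.
pose row t := [seq (t, q) | q <- index_iota (lo (B t) (B t.+1)) (B t.+1)].
have rowE t : (t < size z)%N -> row t = (t, lo (B t) (B t.+1)) ::
    [seq (t, q) | q <- index_iota (lo (B t) (B t.+1)).+1 (B t.+1)].
  move=> tz; rewrite /row /index_iota; have [_ h] := Bs _ tz.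
  by rewrite -[(_ - lo _ _)%N]prednK -?subnS //; rewrite /lo; lia.
have last_row t : (t < size z)%N -> forall c, last c (row t) = (t, (B t.+1).-1).
  move=> tz c; rewrite /row; have [_ h] := Bs _ tz; move: h.
  case: (B t.+1) => // b _; rewrite /index_iota subSn; last by rewrite /lo; lia.
  by rewrite -[(_ - _).+1]addn1 iotaD map_cat last_cat /= subnKC // /lo; lia.
have costE t : path_cost z x (row t) = block_cost x (B t) (B t.+1) z`_t.
  by rewrite /path_cost /row big_map.
have allE t : (t < size z)%N ->
    all (fun c => (c.1 < size z)%N && (c.2 < size x)%N) (row t).
  move=> tz; apply/allP => c /mapP[q]; rewrite mem_index_iota => /andP[_ hq] -> /=.
  by rewrite tz -Bm (leq_trans hq) ?Ble.
suff /(_ (size z).-1) : forall l, (l < size z)%N -> exists p, [/\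
    all (fun c => (c.1 < size z)%N && (c.2 < size x)%N) ((0, 0)%N :: p),
    last (0, 0)%N p = (l, (B l.+1).-1), path wstep (0, 0)%N p
    & path_cost z x ((0, 0)%N :: p)
      = \sum_(0 <= t < l.+1) block_cost x (B t) (B t.+1) z`_t].
  rewrite prednK // leqnn => /(_ isT) [p [h1 h2 h3 h4]].
  by exists ((0, 0)%N :: p); rewrite // /warping_path h1 /= h2 h3 Bm !eqxx.
elim=> [|l IH] lz.
  have row0 := rowE _ z0; rewrite B0 /lo min0n in row0.
  exists [seq (0%N, q) | q <- index_iota 1 (B 1)]; split.
  - by have := allE _ z0; rewrite row0.
  - by have := last_row _ z0 (0, 0)%N; rewrite row0.
  - exact: path_row.
  - by have := costE 0%N; rewrite row0 big_nat1.
have [p [h1 h2 h3 h4]] := IH (ltnW lz).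
exists (p ++ row l.+1); split.
- by rewrite -cat_cons all_cat h1 allE.
- by rewrite last_cat last_row.
- rewrite cat_path h3 rowE //= path_row andbT.
  rewrite h2 /wstep !inE /=; have [b1 b2] := Bs _ lz.
  have [_ b3] := Bs _ (ltnW lz).
  (* Two rows are joined by a step [(1, 1)] in the first case and by a step [(1, 0)] in the
     second. *)
  have : lo (B l.+1) (B l.+2) = B l.+1 \/ lo (B l.+1) (B l.+2) = (B l.+1).-1.
    by rewrite /lo; lia.
  by case=> ->; rewrite ?prednK // eqxx ?orbT.
- by rewrite big_nat_recr //= -h4 -costE /path_cost -cat_cons big_cat.
Qed.

(** * Enumeration of prefix vectors *)

Definition radix (ns : nat -> nat) (j : nat) : nat := (\prod_(0 <= i < j) ns i)%N.

(* Row 0 is the empty prefix of every series, and the rows 1, ..., [radix ns k]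
   enumerate the vectors with entries in 1, ..., [ns j]. *)
Definition digit (ns : nat -> nat) (q j : nat) : nat :=
  if q is q'.+1 then (q' %/ radix ns j %% ns j).+1 else 0%N.

(** Mixed radix notation with series 0 least significant. Entries are shifted to start at 0, and the
    number is shifted up by one because row 0 is the empty prefix. *)
Definition row_index (ns : nat -> nat) (k : nat) (v : nat -> nat) : nat :=
  (\sum_(0 <= j < k) (v j).-1 * radix ns j).+1.

Lemma radixS ns j : radix ns j.+1 = (radix ns j * ns j)%N.
Proof. by rewrite /radix big_nat_recr. Qed.

Section MixedRadix.
Variables (ns : nat -> nat) (k : nat).
Hypothesis ns_gt0 : forall j, (j < k)%N -> (0 < ns j)%N.

Lemma radix_gt0 j : (j <= k)%N -> (0 < radix ns j)%N.
Proof.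
elim: j => [|j IH] jk; first by rewrite /radix big_geq.
by rewrite radixS muln_gt0 IH ?ns_gt0 // ltnW.
Qed.

Lemma digit_bounds q j : (j < k)%N -> (0 < q)%N -> (0 < digit ns q j <= ns j)%N.
Proof. by case: q => // q jk _; rewrite /= ltn_pmod ?ns_gt0. Qed.

(** The sum telescopes, since [(ns j).-1 * radix ns j] is a difference of consecutive radices. So
    the vector of full lengths is the last row. *)
Lemma row_index_max : row_index ns k ns = radix ns k.
Proof.
rewrite /row_index; elim: k ns_gt0 => [|m IH] h; first by rewrite /radix !big_geq.
rewrite big_nat_recr //= -addSn IH; last by move=> j jm; apply: h; apply: ltnW.
by rewrite -mulSn radixS prednK ?h // mulnC.
Qed.

Lemma leq_row_index v v' : (forall j, j < k -> v j <= v' j)%N ->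
  (row_index ns k v <= row_index ns k v')%N.
Proof.
move=> h; rewrite ltnS big_nat [leqRHS]big_nat; apply: leq_sum => j /h hj.
by rewrite leq_mul2r -!subn1 leq_sub2r ?orbT.
Qed.

Lemma row_index_le v : (forall j, j < k -> v j <= ns j)%N ->
  (row_index ns k v <= radix ns k)%N.
Proof. by rewrite -row_index_max; apply: leq_row_index. Qed.

Lemma digit_row_index v j : (forall j, j < k -> 0 < v j <= ns j)%N ->
  (j < k)%N -> digit ns (row_index ns k v) j = v j.
Proof.
move=> hv jk; pose U m := (\sum_(0 <= j < m) (v j).-1 * radix ns j)%N.
have Ult m : (m <= k)%N -> (U m < radix ns m)%N.
  elim: m => [|m IH] mk; first by rewrite /U big_geq // radix_gt0.
  rewrite /U big_nat_recr //= -/(U m) radixS.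
  have /andP[v0 vn] := hv _ mk; have := IH (ltnW mk).
  by move: v0 vn; case: (v m) => // d _ /=; nia.
(* The digits above [j] contribute a multiple of [radix ns j * ns j], which the remainder modulo
   [ns j] removes; those below [j] stay under [radix ns j] by [Ult] and vanish in the quotient. *)
have [r hr] : exists r, U k = (U j + ((v j).-1 + r * ns j) * radix ns j)%N.
  rewrite -(subnKC jk); elim: (k - j.+1)%N => [|l IH].
    by exists 0%N; rewrite addn0 /U big_nat_recr //= mul0n addn0.
  have [r hr] := IH.
  have [c hc] : exists c, radix ns (j.+1 + l) = (c * ns j * radix ns j)%N.
    elim: l {IH hr} => [|l [c hc]].
      by exists 1%N; rewrite addn0 radixS mul1n mulnC.
    by exists (c * ns (j.+1 + l))%N; rewrite addnS radixS hc; nia.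
  exists (r + (v (j.+1 + l)%N).-1 * c)%N.
  by rewrite addnS /U big_nat_recr //= -/(U _) hr hc; ring.
rewrite /digit /row_index -/(U k) hr [(U j + _)%N]addnC divnMDl ?radix_gt0 1?ltnW //.
rewrite divn_small ?Ult 1?ltnW // addn0 addnC modnMDl modn_small.
  by rewrite prednK //; have /andP[] := hv _ jk.
by have /andP[v0 vn] := hv _ jk; rewrite prednK.
Qed.

Lemma digit_max j : (j < k)%N -> digit ns (radix ns k) j = ns j.
Proof.
by move=> jk; rewrite -row_index_max digit_row_index // => i ik; rewrite leqnn ns_gt0.
Qed.

End MixedRadix.

(** * Optimality of the dynamic program *)

(* At a = 0 the hypotheses force b = 0, and b / 0 = 0. *)
Lemma quadratic_min (a b c : rat) : 0 <= a ->
  (forall v, 0 <= c - 2 * v * b + v ^+ 2 * a) ->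
  (forall v, c - b * b / a <= c - 2 * v * b + v ^+ 2 * a)
  /\ c - b * b / a = c - 2 * (b / a) * b + (b / a) ^+ 2 * a.
Proof.
rewrite le_eqVlt => /predU1P[<-|a0] h; last first.
  have an0 : a != 0 by rewrite gt_eqF.
  split=> [v|]; last by field.
  rewrite -subr_ge0.
  have ->: c - 2 * v * b + v ^+ 2 * a - (c - b * b / a) = (b / a - v) ^+ 2 * a.
    by field.
  by rewrite mulr_ge0 ?sqr_ge0 ?ltW.
have [b0|bn0] := eqVneq b 0; last first.
  (* For [a = 0] the polynomial is linear in [v]; this argument is the one at which it takes the
     value -1. *)
  have := h ((c + 1) / (2 * b)).
  have -> : c - 2 * ((c + 1) / (2 * b)) * b + ((c + 1) / (2 * b)) ^+ 2 * 0 = -1.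
    by field.
  by [].
by rewrite b0; split=> [v|]; rewrite !(mul0r, mulr0, subr0, addr0, invr0).
Qed.

Section Steps.
Variables (k : nat) (x : seq (seq rat)) (w : seq rat).

Definition len (j : nat) : nat := nth 0%N (map size x) j.
Definition ser (j : nat) : seq rat := nth [::] x j.

Definition moment (f : rat -> rat) (a b : nat -> nat) : rat :=
  \sum_(0 <= j < k) \sum_(lo (a j) (b j) <= p < b j) w`_j * f (ser j)`_p.

Definition step_cost (a b : nat -> nat) : rat :=
  moment (fun r => r * r) a b
    - moment id a b * moment id a b / moment (fun=> 1) a b.

Definition step_mean (a b : nat -> nat) : rat := moment id a b / moment (fun=> 1) a b.

Definition step_cost_at (v : rat) (a b : nat -> nat) : rat :=
  \sum_(0 <= j < k) w`_j * block_cost (ser j) (a j) (b j) v.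

Lemma size_ser j : size (ser j) = len j.
Proof.
rewrite /len /ser; have [jx|jx] := ltnP j (size x); first by rewrite (nth_map [::]).
by rewrite !nth_default ?size_map.
Qed.

Lemma step_cost_atE v a b : step_cost_at v a b =
  moment (fun r => r * r) a b - 2 * v * moment id a b
    + v ^+ 2 * moment (fun=> 1) a b.
Proof.
rewrite /step_cost_at /moment /block_cost !mulr_sumr -sumrB -big_split /=.
apply: eq_bigr => j _; rewrite !mulr_sumr -sumrB -big_split /=.
by apply: eq_bigr => p _; ring.
Qed.

Hypothesis w_ge0 : forall j, (j < k)%N -> 0 <= w`_j.

Lemma step_cost_at_ge0 v a b : 0 <= step_cost_at v a b.
Proof.
rewrite /step_cost_at big_nat; apply: sumr_ge0 => j jk.
by rewrite mulr_ge0 ?w_ge0 ?block_cost_ge0.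
Qed.

(** The quadratic in [v] is a weighted sum of squares, hence nonnegative everywhere, which also
    covers blocks of total weight 0. *)
Lemma step_cost_quadratic a b :
  (forall v, step_cost a b <= step_cost_at v a b)
  /\ step_cost a b = step_cost_at (step_mean a b) a b.
Proof.
have [||h1 h2] := @quadratic_min (moment (fun=> 1) a b) (moment id a b)
  (moment (fun r => r * r) a b).
- rewrite /moment big_nat; apply: sumr_ge0 => j jk; apply: sumr_ge0 => p _.
  by rewrite mulr1 w_ge0.
- by move=> v; rewrite -step_cost_atE step_cost_at_ge0.
- by split=> [v|]; rewrite step_cost_atE.
Qed.

Lemma eq_step_cost a a' b b' :
  (forall j, j < k -> a j = a' j)%N -> (forall j, j < k -> b j = b' j)%N ->
  step_cost a b = step_cost a' b'.
Proof.
move=> ha hb; have momE f : moment f a b = moment f a' b'.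
  by apply: eq_big_nat => j /andP[_ jk]; rewrite ha ?hb.
by rewrite /step_cost !momE.
Qed.

(** The edges of the graph of prefix vectors. The numbering of rows is a linear order that refines
    this relation. *)
Definition row_le (e q : nat) : Prop :=
  forall j, (j < k)%N -> (digit len e j <= digit len q j)%N.

(** The tables are described only by their Bellman equations, so that optimality can be proved apart
    from the program that fills them. *)
Record dp_solution (D : nat -> rat) (nxt : nat -> nat) (val : nat -> rat) : Prop :=
  DpSolution {
    dp_last : D (radix len k) = 0;
    dp_next : forall e, (e < radix len k)%N ->
      [/\ (e < nxt e <= radix len k)%N, row_le e (nxt e),
          D e = D (nxt e) + step_cost (digit len e) (digit len (nxt e))
        & val e = step_mean (digit len e) (digit len (nxt e))];
    dp_min : forall e q, (e < q <= radix len k)%N -> row_le e q ->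
      D e <= D q + step_cost (digit len e) (digit len q)
  }.

Hypothesis len_gt0 : forall j, (j < k)%N -> (0 < len j)%N.

(** [D] acts as a potential: along the rows visited by [z] it drops at each entry by at most the
    optimal step cost, which is at most the cost of the actual entry. Summing backwards from the
    last row, where [D] is 0, gives the bound. *)
Lemma dp_lower D nxt val (z : seq rat) (B : nat -> nat -> nat) :
  dp_solution D nxt val -> (0 < size z)%N ->
  (forall j, (j < k)%N -> is_ends (size z) (len j) (B j)) ->
  D 0%N <= \sum_(0 <= t < size z) step_cost_at z`_t (B^~ t) (B^~ t.+1).
Proof.
move=> [D0 _ Dmin] z0 hB.
have Bpos t j : (j < k)%N -> (0 < t <= size z)%N -> (0 < B j t)%N.
  by case: t => // t /hB[_ _ h] /= /h[].
have Blen t j : (j < k)%N -> (t <= size z)%N -> (B j t <= len j)%N.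
  by move=> /hB h tz; case: (h) => _ <- _; apply: ends_le h _ _ tz _.
(* [row_index] is always positive, so the empty prefix needs its own case. *)
pose idx t := if t is 0 then 0%N else row_index len k (B^~ t).
have idxE t j : (j < k)%N -> (t <= size z)%N -> digit len (idx t) j = B j t.
  case: t => [/hB[-> //]|t] jk tz; rewrite digit_row_index // => i ik.
  by rewrite Blen // Bpos.
have idx_last : idx (size z) = radix len k.
  rewrite -row_index_max //; case: (size z) z0 hB => // m _ hB; congr _.+1.
  by apply: eq_big_nat => j /andP[_ /hB[_ -> _]].
suff h l : (l <= size z)%N ->
    D (idx (size z - l)%N)
      <= \sum_(size z - l <= t < size z) step_cost_at z`_t (B^~ t) (B^~ t.+1).
  by have := h _ (leqnn _); rewrite subnn.
elim: l => [|l IH] lz; first by rewrite subn0 idx_last D0 big_geq.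
set t := (size z - l.+1)%N; have tz : (t < size z)%N by lia.
have tS : (size z - l)%N = t.+1 by lia.
rewrite tS in IH; rewrite big_ltn //.
have Bmono j : (j < k)%N -> (B j t <= B j t.+1)%N by move=> /hB[_ _ /(_ _ tz)[]].
have idx_le : (idx t <= idx t.+1)%N.
  by case: (t) Bmono => // u Bmono; apply: leq_row_index.
have idxt := idxE _ _ _ (ltnW tz); have idxt1 := idxE _ _ _ tz.
move: idx_le; rewrite leq_eqVlt => /predU1P[->|idx_lt].
  by apply: le_trans (IH (ltnW lz)) _; rewrite lerDr step_cost_at_ge0.
apply: le_trans (Dmin (idx t) (idx t.+1) _ _) _.
- rewrite idx_lt /= row_index_le // => j jk; exact: Blen.
- by move=> j jk; rewrite idxt // idxt1 ?Bmono.
rewrite addrC lerD ?IH 1?ltnW //.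
rewrite (@eq_step_cost _ (B^~ t) _ (B^~ t.+1)) => [||j jk]; last by rewrite idxt1.
- by have [] := step_cost_quadratic (B^~ t) (B^~ t.+1).
- by move=> j jk; rewrite idxt.
Qed.

(** Along [nxt] the inequalities of the lower bound become equalities, since [val] is the entry at
    which the step cost is attained. *)
Lemma dp_upper D nxt val m (u := fun t => iter t nxt 0%N) :
  dp_solution D nxt val ->
  u m = radix len k -> (forall t, (t < m)%N -> (u t < radix len k)%N) ->
  [/\ (0 < m)%N, forall j, (j < k)%N -> is_ends m (len j) (fun t => digit len (u t) j)
    & D 0%N = \sum_(0 <= t < m)
        step_cost_at (val (u t)) (digit len (u t)) (digit len (u t.+1))].
Proof.
move=> [D0 Dn _] um ut.
have m0 : (0 < m)%N.
  by case: m um {ut} => // um; have := radix_gt0 len_gt0 (leqnn k); rewrite -um.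
split=> //.
- move=> j jk; split=> //; first by rewrite um digit_max.
  move=> t /ut /Dn[/andP[h _] hle _ _]; split; first exact: hle.
  by have [] := andP (digit_bounds len_gt0 jk (leq_ltn_trans (leq0n _) h)).
- suff h l : (l <= m)%N -> D (u (m - l)%N) = \sum_(m - l <= t < m)
      step_cost_at (val (u t)) (digit len (u t)) (digit len (u t.+1)).
    by have := h _ (leqnn _); rewrite subnn.
  elim: l => [|l IH] lm; first by rewrite subn0 um D0 big_geq.
  set t := (m - l.+1)%N; have tm : (t < m)%N by lia.
  have tS : (m - l)%N = t.+1 by lia.
  rewrite tS in IH; rewrite big_ltn // -IH 1?ltnW //.
  have [_ _ -> ->] := Dn _ (ut _ tm).
  have [_ ->] := step_cost_quadratic (digit len (u t)) (digit len (nxt (u t))).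
  by rewrite addrC.
Qed.

End Steps.

Lemma momentS k x w f a b : moment k.+1 x w f a b = moment k x w f a b
  + \sum_(lo (a k) (b k) <= p < b k) w`_k * f (ser x k)`_p.
Proof. by rewrite /moment big_nat_recr. Qed.

(** * From prefix vectors back to the weighted Fréchet function *)

Section Frechet.
Variables (R : realType) (k : nat) (x : k.-tuple (seq rat)) (w : k.-tuple rat).
Hypothesis x_gt0 : forall i, (0 < size (tnth x i))%N.
Hypothesis w_ge0 : forall i, 0 <= tnth w i.

Lemma sqr_sqrt_path_cost (z y : seq rat) p :
  Num.sqrt (ratr (path_cost z y p) : R) ^+ 2 = ratr (path_cost z y p).
Proof. by rewrite sqr_sqrtr // ler0q; apply: sumr_ge0 => c _; exact: sqr_ge0. Qed.

(** Together with [frechet_attained] this replaces the real-valued distances by rational path costs,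
    so that the comparison of two candidates takes place in [rat]. *)
Lemma frechet_le z (p : 'I_k -> seq (nat * nat)) : (0 < size z)%N ->
  (forall i, warping_path (size z) (size (tnth x i)) (p i)) ->
  frechet R x w z <= ratr (\sum_i tnth w i * path_cost z (tnth x i) (p i)).
Proof.
move=> z0 hp; rewrite raddf_sum /=; apply: ler_sum => i _.
rewrite rmorphM ler_wpM2l ?ler0q //=.
have [q [_ -> hq]] := dtw_min R z0 (x_gt0 i).
by rewrite -(sqr_sqrt_path_cost _ _ (p i)) lerXn2r ?nnegrE ?sqrtr_ge0 ?hq.
Qed.

Lemma frechet_attained z : (0 < size z)%N ->
  exists2 p : 'I_k -> seq (nat * nat),
    forall i, warping_path (size z) (size (tnth x i)) (p i)
    & frechet R x w z = ratr (\sum_i tnth w i * path_cost z (tnth x i) (p i)).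
Proof.
move=> z0; have [p hp] := fin_all_exists (fun i => dtw_min R z0 (x_gt0 i)).
exists p => [i|]; first by have [] := hp i.
rewrite raddf_sum; apply: eq_bigr => i _; have [_ -> _] := hp i.
by rewrite /= sqr_sqrt_path_cost rmorphM.
Qed.

(** [D 0] separates the two sides: the blocks along [nxt] give paths for [z] of total cost [D 0],
    while optimal paths of any [z'] yield block ends to which [dp_lower] applies. *)
Lemma dp_optimal D nxt val m (u := fun t => iter t nxt 0%N) :
  dp_solution k x w D nxt val ->
  u m = radix (len x) k -> (forall t, (t < m)%N -> (u t < radix (len x) k)%N) ->
  is_weighted_dtw_mean R x w (mkseq (fun t => val (u t)) m).
Proof.
move=> hD um ut; set z := mkseq _ _.
have serE (i : 'I_k) : ser x i = tnth x i by rewrite /ser (tnth_nth [::]).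
have lenE (i : 'I_k) : len x i = size (tnth x i) by rewrite -serE size_ser.
have wE (i : 'I_k) : w`_i = tnth w i by rewrite (tnth_nth 0).
have len_gt0 j : (j < k)%N -> (0 < len x j)%N.
  by move=> jk; rewrite -[j]/(nat_of_ord (Ordinal jk)) lenE.
have w0 j : (j < k)%N -> 0 <= w`_j.
  by move=> jk; rewrite -[j]/(nat_of_ord (Ordinal jk)) wE.
have [m0 hB D0] := dp_upper w0 len_gt0 hD um ut.
have sz : size z = m by rewrite size_mkseq.
split=> [|z' z'0]; first by rewrite sz.
have [p hp hcost] : exists2 p : 'I_k -> seq (nat * nat),
    forall i, warping_path (size z) (size (tnth x i)) (p i)
    & forall i, path_cost z (tnth x i) (p i) = \sum_(0 <= t < m)
        block_cost (tnth x i) (digit (len x) (u t) i) (digit (len x) (u t.+1) i) z`_t.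
  have h (i : 'I_k) : exists p, warping_path (size z) (size (tnth x i)) p
      /\ path_cost z (tnth x i) p = \sum_(0 <= t < m)
        block_cost (tnth x i) (digit (len x) (u t) i) (digit (len x) (u t.+1) i) z`_t.
    have [||p p1 p2] := @ends_path z (tnth x i) (fun t => digit (len x) (u t) i).
    - by rewrite sz.
    - by rewrite sz -lenE; apply: hB (ltn_ord i).
    - by exists p; split=> //; rewrite p2 sz.
  have [p hp] := fin_all_exists h.
  by exists p => i; have [] := hp i.
apply: le_trans (frechet_le _ hp) _; first by rewrite sz.
have [p' hp' ->] := frechet_attained z'0; rewrite ler_rat.
have [B hB'] := fin_all_exists2 (fun i => path_ends (hp' i)).
(* Extends the ends from ordinals to all naturals, with the dummy value 0 outside the range. *)
move=> hB'cost; pose B' j t := oapp (fun i => B i t) 0%N (insub j).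
have B'E (i : 'I_k) t : B' i t = B i t by rewrite /B' valK.
apply: (@le_trans _ _ (D 0%N)).
  rewrite D0 /step_cost_at exchange_big /= big_mkord le_eqVlt; apply/orP; left.
  apply/eqP; apply: eq_bigr => i _; rewrite hcost mulr_sumr wE serE.
  by apply: eq_big_nat => t /andP[_ tm]; rewrite nth_mkseq.
apply: le_trans (dp_lower (B := B') w0 len_gt0 hD z'0 _) _.
- move=> j jk; have [b1 b2 b3] := hB' (Ordinal jk).
  by rewrite -[j]/(nat_of_ord (Ordinal jk)); split => [||t tz];
    rewrite !B'E ?lenE //; apply: b3.
rewrite /step_cost_at exchange_big /= big_mkord; apply: ler_sum => i _.
rewrite -mulr_sumr wE serE ler_wpM2l //; apply: le_trans (hB'cost i).
by apply: ler_sum => t _; rewrite !B'E.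
Qed.

End Frechet.

(** * Timed execution *)

Fixpoint imods (c : cmd) : seq nat :=
  match c with
  | CISet a _ _ => [:: a]
  | CSeq c1 c2 | CIf _ c1 c2 => imods c1 ++ imods c2
  | CWhile _ c1 => imods c1
  | _ => [::]
  end.

Fixpoint qmods (c : cmd) : seq nat :=
  match c with
  | CQSet a _ _ => [:: a]
  | CSeq c1 c2 | CIf _ c1 c2 => qmods c1 ++ qmods c2
  | CWhile _ c1 => qmods c1
  | _ => [::]
  end.

(** Array names are numerals in the program text, so there is no aliasing and a syntactic list of
    the assigned arrays suffices. *)
Definition frame (c : cmd) (s s' : store) : Prop :=
  (forall a, a \notin imods c -> forall i, imem s' a i = imem s a i) /\
  (forall a, a \notin qmods c -> forall i, qmem s' a i = qmem s a i).

Lemma exec_frame c s s' t : exec c s s' t -> frame c s s'.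
Proof.
elim=> {c s s' t} //.
- move=> a e v s; split=> // b /=; rewrite inE => /negbTE ba i.
  by rewrite /upd ba.
- move=> a e v s; split=> // b /=; rewrite inE => /negbTE ba i.
  by rewrite /upd ba.
- move=> c1 c2 s s1 s2 t1 t2 _ [h1 h2] _ [h3 h4].
  by split=> a /=; rewrite mem_cat negb_or => /andP[a1 a2] i;
    rewrite ?h3 ?h1 ?h4 ?h2.
- move=> b c1 c2 s s' t _ _ [h1 h2].
  by split=> a /=; rewrite mem_cat negb_or => /andP[a1 a2] i; rewrite ?h1 ?h2.
- move=> b c1 c2 s s' t _ _ [h1 h2].
  by split=> a /=; rewrite mem_cat negb_or => /andP[a1 a2] i; rewrite ?h1 ?h2.
- move=> b c s s1 s2 t1 t2 _ _ [h1 h2] _ [h3 h4].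
  by split=> a /= h i; rewrite ?h3 ?h1 ?h4 ?h2.
Qed.

(** Total correctness with an upper bound on the cost, in weakest precondition form. The rules build
    [T] along the program, so it can stay an existential variable until it is compared with a closed
    bound. *)
Definition runs (c : cmd) (s : store) (T : nat) (Q : store -> Prop) : Prop :=
  exists s' t, [/\ exec c s s' t, (t <= T)%N & Q s'].

Lemma runs_weaken c s T T' (Q Q' : store -> Prop) :
  runs c s T Q -> (T <= T')%N -> (forall s', frame c s s' -> Q s' -> Q' s') ->
  runs c s T' Q'.
Proof.
move=> [s' [t [h tT hQ]]] TT hQQ'; exists s', t; split=> //; first exact: leq_trans TT.
exact: hQQ' (exec_frame h) hQ.
Qed.

Lemma runs_cost c s T T' (Q : store -> Prop) :
  runs c s T Q -> (T <= T')%N -> runs c s T' Q.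
Proof. by move=> h TT; apply: runs_weaken h TT _. Qed.

Lemma runs_skip s (Q : store -> Prop) : Q s -> runs CSkip s 1 Q.
Proof. by move=> hQ; exists s, 1%N; split=> //; constructor. Qed.

Lemma runs_iset a e v s (Q : store -> Prop) :
  Q (Store (upd (imem s) a (ieval s e) (ieval s v)) (qmem s)) ->
  runs (CISet a e v) s (icost e + icost v).+1 Q.
Proof. by move=> hQ; do 2 eexists; split; [constructor| |exact: hQ]. Qed.

Lemma runs_qset a e v s (Q : store -> Prop) :
  Q (Store (imem s) (upd (qmem s) a (ieval s e) (qeval s v))) ->
  runs (CQSet a e v) s (icost e + qcost v).+1 Q.
Proof. by move=> hQ; do 2 eexists; split; [constructor| |exact: hQ]. Qed.

Lemma runs_seq c1 c2 s T1 T2 (Q : store -> Prop) :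
  runs c1 s T1 (fun s1 => runs c2 s1 T2 Q) -> runs (CSeq c1 c2) s (T1 + T2) Q.
Proof.
move=> [s1 [t1 [h1 tT1 [s2 [t2 [h2 tT2 hQ]]]]]]; exists s2, (t1 + t2)%N.
by split=> //; [apply: exec_seq h1 h2|rewrite leq_add].
Qed.

(** Adding the bounds of both branches, instead of taking the larger, keeps the cost a polynomial
    for the final arithmetic. *)
Lemma runs_if b c1 c2 s T1 T2 (Q : store -> Prop) :
  (beval s b -> runs c1 s T1 Q) -> (~~ beval s b -> runs c2 s T2 Q) ->
  runs (CIf b c1 c2) s (bcost b + (T1 + T2)).+1 Q.
Proof.
move=> h1 h2; have [hb|hb] := boolP (beval s b).
  have [s' [t [h tT hQ]]] := h1 hb; exists s', (bcost b + t).+1.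
  by split=> //; [apply: exec_if_true|rewrite ltnS leq_add2l (leq_trans tT) ?leq_addr].
have [s' [t [h tT hQ]]] := h2 hb; exists s', (bcost b + t).+1.
by split=> //; [apply: exec_if_false|rewrite ltnS leq_add2l (leq_trans tT) ?leq_addl].
Qed.

Lemma runs_then c1 c2 s T1 T2 (Q1 Q : store -> Prop) :
  runs c1 s T1 Q1 -> (forall s1, frame c1 s s1 -> Q1 s1 -> runs c2 s1 T2 Q) ->
  runs (CSeq c1 c2) s (T1 + T2) Q.
Proof.
by move=> h1 h2; apply: runs_seq; apply: runs_weaken h1 _ h2; exact: leqnn.
Qed.

(** The invariant is indexed by the number of completed rounds, [m] is their exact total, and the
    last summand pays for the failing test. The frame refers to the state before the loop, so the
    invariant need not repeat what the body never writes. *)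
Lemma runs_while (I : nat -> store -> Prop) m b c s T (Q : store -> Prop) :
  I 0%N s ->
  (forall i s', (i < m)%N -> frame c s s' -> I i s' ->
    beval s' b /\ runs c s' T (I i.+1)) ->
  (forall s', frame c s s' -> I m s' -> ~~ beval s' b /\ Q s') ->
  runs (CWhile b c) s (m * (bcost b + T).+1 + (bcost b).+1) Q.
Proof.
move=> I0 IS IQ; suff h l s1 i : (i + l = m)%N -> frame c s s1 -> I i s1 ->
    runs (CWhile b c) s1 (l * (bcost b + T).+1 + (bcost b).+1) Q.
  by apply: h I0.
elim: l s1 i => [|l IH] s1 i.
  rewrite addn0 => -> fr /(IQ _ fr)[hb hQ]; exists s1, (bcost b).+1.
  by split=> //; exact: exec_while_false.
move=> il fr hI; have [|hb [s2 [t2 [h2 tT2 I2]]]] := IS i s1 _ fr hI.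
  by rewrite -il addnS ltnS leq_addr.
have fr2 : frame c s s2.
  by have [f1 f2] := exec_frame h2; case: fr => g1 g2; split=> a ha j;
    rewrite ?f1 ?g1 ?f2 ?g2.
have [|s3 [t3 [h3 tT3 hQ]]] := IH s2 i.+1 _ fr2 I2; first by rewrite addSnnS.
exists s3, (bcost b + t2 + t3).+1; split=> //.
  exact: exec_while_true hb h2 h3.
by rewrite mulSn; lia.
Qed.

(** * The program *)

(* Names of arrays: [a...] for index arrays, [d...] for data arrays.  Every name other
   than [aLen], [aDigit], [aNext], [dW], [dX], [dOut], [dD], [dMean] is a scalar kept in
   cell 0.  [aC] is a carry in [fill_rows] and counts violations of [row_le] in
   [moments]; [dM0], [dM1], [dM2] hold the weighted moments. *)
Local Notation aK := 0%N (only parsing).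
Local Notation aLen := 1%N (only parsing).
Local Notation aOut := 2%N (only parsing).
Local Notation aN := 3%N (only parsing).
Local Notation aDigit := 4%N (only parsing).
Local Notation aJ := 5%N (only parsing).
Local Notation aQ := 6%N (only parsing).
Local Notation aC := 7%N (only parsing).
Local Notation aE := 8%N (only parsing).
Local Notation aOff := 9%N (only parsing).
Local Notation aP := 10%N (only parsing).
Local Notation aNext := 11%N (only parsing).
Local Notation aCur := 12%N (only parsing).

Local Notation dW := 0%N (only parsing).
Local Notation dX := 1%N (only parsing).
Local Notation dOut := 2%N (only parsing).
Local Notation dM1 := 3%N (only parsing).
Local Notation dM0 := 4%N (only parsing).
Local Notation dM2 := 5%N (only parsing).
Local Notation dD := 6%N (only parsing).
Local Notation dMean := 7%N (only parsing).

Definition var (a : nat) : iexp := IGet a (IConst 0).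
Definition qvar (a : nat) : qexp := QGet a (IConst 0).
Definition iset (a : nat) (v : iexp) : cmd := CISet a (IConst 0) v.
Definition qset (a : nat) (v : qexp) : cmd := CQSet a (IConst 0) v.
Definition incr (a : nat) : cmd := iset a (IAdd (var a) (IConst 1)).
Definition ilt (e1 e2 : iexp) : bexp := BILe (IAdd e1 (IConst 1)) e2.
Definition cell (q : iexp) : iexp := IAdd (IMul q (var aK)) (var aJ).
Definition dig (a : nat) : iexp := IGet aDigit (cell (var a)).
Definition len_j : iexp := IGet aLen (var aJ).
Definition entry : qexp := QGet dX (IAdd (var aOff) (var aP)).
Definition weight : qexp := QGet dW (var aJ).

Local Notation "c1 ;; c2" := (CSeq c1 c2) (at level 90, right associativity).

Definition count_body : cmd := iset aN (IMul (var aN) len_j) ;; incr aJ.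

Definition count_rows : cmd :=
  iset aN (IConst 1) ;; iset aJ (IConst 0) ;;
  CWhile (ilt (var aJ) (var aK)) count_body.

(* Array [aC] carries: it increments row [q] into row [q.+1], and turns the zero
   row into the row of ones without losing the carry. *)
Definition digit_body : cmd :=
  CIf (BILe (IAdd (dig aQ) (var aC)) len_j)
    (CISet aDigit (cell (IAdd (var aQ) (IConst 1))) (IAdd (dig aQ) (var aC)) ;;
     iset aC (ISub (IConst 1) (dig aQ)))
    (CISet aDigit (cell (IAdd (var aQ) (IConst 1))) (IConst 1)) ;;
  incr aJ.

Definition row_body : cmd :=
  iset aC (IConst 1) ;; iset aJ (IConst 0) ;;
  CWhile (ilt (var aJ) (var aK)) digit_body ;;
  incr aQ.

Definition fill_rows : cmd :=
  iset aQ (IConst 0) ;; CWhile (ilt (var aQ) (var aN)) row_body.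

Definition entry_body : cmd :=
  qset dM1 (QAdd (qvar dM1) (QMul weight entry)) ;;
  qset dM0 (QAdd (qvar dM0) weight) ;;
  qset dM2 (QAdd (qvar dM2) (QMul weight (QMul entry entry))) ;;
  incr aP.

(* In truncated arithmetic [a - (a + 1 - b)] is [lo a b] for positive [b]. *)
Definition block_body : cmd :=
  iset aC (IAdd (var aC) (ISub (dig aE) (dig aQ))) ;;
  iset aP (ISub (dig aE) (ISub (IAdd (dig aE) (IConst 1)) (dig aQ))) ;;
  CWhile (ilt (var aP) (dig aQ)) entry_body ;;
  iset aOff (IAdd (var aOff) len_j) ;;
  incr aJ.

Definition moments : cmd :=
  qset dM1 (QConst 0) ;; qset dM0 (QConst 0) ;; qset dM2 (QConst 0) ;;
  iset aC (IConst 0) ;; iset aOff (IConst 0) ;; iset aJ (IConst 0) ;;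
  CWhile (ilt (var aJ) (var aK)) block_body.

Definition candidate : qexp :=
  QAdd (QGet dD (var aQ))
    (QSub (qvar dM2) (QDiv (QMul (qvar dM1) (qvar dM1)) (qvar dM0))).

(** Successors come in decreasing order, so [N] is the first. It is accepted without a comparison,
    as [dD] holds no meaningful value at row [e] yet. Ties keep the larger successor. *)
Definition relax : cmd :=
  CIf (BAnd (BILe (var aC) (IConst 0))
        (BNot (BAnd (ilt (var aQ) (var aN)) (BQLe (QGet dD (var aE)) candidate))))
    (CQSet dD (var aE) candidate ;;
     CQSet dMean (var aE) (QDiv (qvar dM1) (qvar dM0)) ;;
     CISet aNext (var aE) (var aQ))
    CSkip.

Definition scan_body : cmd := moments ;; relax ;; iset aQ (ISub (var aQ) (IConst 1)).

Definition solve_body : cmd :=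
  iset aE (ISub (var aE) (IConst 1)) ;;
  iset aQ (var aN) ;;
  CWhile (ilt (var aE) (var aQ)) scan_body.

Definition solve : cmd :=
  iset aE (var aN) ;; CWhile (ilt (IConst 0) (var aE)) solve_body.

Definition emit_body : cmd :=
  CQSet dOut (var aOut) (QGet dMean (var aCur)) ;;
  incr aOut ;;
  iset aCur (IGet aNext (var aCur)).

Definition emit : cmd :=
  iset aCur (IConst 0) ;; CWhile (ilt (var aCur) (var aN)) emit_body.

Definition dtw_mean_program : cmd := count_rows ;; fill_rows ;; solve ;; emit.

(** * Correctness and running time of the program *)

Section Correctness.
Variables (x : seq (seq rat)) (w : seq rat) (n : nat).
Let k := size x.
Let N := radix (len x) k.
Let digits := digit (len x).
Hypothesis len_gt0 : forall j, (j < k)%N -> (0 < len x j)%N.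
Hypothesis len_le : forall j, (len x j <= n)%N.

Definition reads_input (s : store) : Prop :=
  [/\ imem s aK 0 = k, forall j, imem s aLen j = len x j,
      forall j, qmem s dW j = w`_j & forall i, qmem s dX i = (flatten x)`_i].

Definition reads_digits (s : store) : Prop :=
  imem s aN 0 = N /\
  forall q j, (q <= N)%N -> (j < k)%N -> imem s aDigit (q * k + j)%N = digits q j.

Lemma frame_input c s s' : frame c s s' ->
  [&& aK \notin imods c, aLen \notin imods c, dW \notin qmods c & dX \notin qmods c] ->
  reads_input s -> reads_input s'.
Proof.
move=> [f1 f2] /and4P[a1 a2 a3 a4] [h1 h2 h3 h4].
by split=> *; rewrite ?f1 ?f2.
Qed.

Lemma frame_digits c s s' : frame c s s' ->
  (aN \notin imods c) && (aDigit \notin imods c) ->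
  reads_digits s -> reads_digits s'.
Proof.
by move=> [f _] /andP[a1 a2] [h1 h2]; split=> *; rewrite f // h2.
Qed.

Lemma count_rows_runs s : reads_input s ->
  runs count_rows s (k * 30 + 30) (fun s' => imem s' aN 0 = N).
Proof.
move=> hin; eapply runs_cost.
- eapply runs_seq, runs_iset, runs_seq, runs_iset.
  apply: (runs_while (I := fun i s' => imem s' aJ 0 = i /\ imem s' aN 0 = radix (len x) i)
    (m := k)).
  + by rewrite /radix big_geq.
  + move=> i s' ik /frame_input /(_ isT hin) [h1 h2 _ _] [hJ hN]; split.
      by rewrite /= hJ h1 addn1.
    eapply runs_seq, runs_iset, runs_iset.
    by rewrite /= /upd /= hJ hN h2 radixS addn1.
  + move=> s' /frame_input /(_ isT hin) [h1 _ _ _] [hJ hN]; split; last exact: hN.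
    by rewrite /= hJ h1 addn1 ltnn.
- by rewrite /=; lia.
Qed.

Lemma cell_inj q j q' j' : (j < k)%N -> (j' < k)%N ->
  (q * k + j == q' * k + j')%N = (q == q') && (j == j').
Proof.
move=> jk jk'; apply/eqP/andP => [h|[/eqP-> /eqP->] //].
have k0 : (0 < k)%N by apply: leq_ltn_trans jk.
have := congr1 (divn^~ k) h; rewrite !divnMDl // !divn_small // !addn0 => e.
by move: h; rewrite e => /addnI ->; rewrite !eqxx.
Qed.

(** Rows [q] and [q.+1] encode the numbers [q.-1] and [q] when [q] is positive, so the carry into
    digit [j] is the difference of their quotients by the radix. From the zero row the carry is
    always 1. *)
Definition carries (q j c : nat) : Prop :=
  if q is q'.+1 then (q %/ radix (len x) j = q' %/ radix (len x) j + c)%N /\ (c <= 1)%N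
  else c = 1%N.

(** Without overflow the next carry [1 - digits q j] is 0 for positive [q], where digits are
    positive, and 1 for the zero row, all of whose digits must become 1. An overflow happens only
    with carry 1, which is passed on. *)
Lemma digit_carry q j c : (j < k)%N -> carries q j c ->
  if (digits q j + c <= len x j)%N
  then digits q.+1 j = (digits q j + c)%N /\ carries q j.+1 (1 - digits q j)
  else digits q.+1 j = 1%N /\ carries q j.+1 c.
Proof.
move=> jk; have r0 := radix_gt0 len_gt0 (ltnW jk); have n0 := len_gt0 jk.
case: q => [|q] /=; first by move=> ->; rewrite n0 div0n mod0n.
move=> [hq c1]; rewrite hq radixS !divnMA hq.
set a := (q %/ _)%N; have := divn_eq a (len x j); have := ltn_pmod a n0.
set r := (a %% _)%N; set b := (a %/ _)%N => rn ae.
case: ifP => h.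
  have ac : (a + c = b * len x j + (r + c))%N by rewrite ae addnA.
  rewrite ac modnMDl divnMDl // modn_small ?divn_small ?addn0 //; lia.
have ac : (a + c = b.+1 * len x j + 0)%N by rewrite mulSn; lia.
by rewrite ac modnMDl divnMDl // mod0n div0n; split=> //; split=> //; lia.
Qed.

Lemma fill_rows_runs s : reads_input s -> imem s aN 0 = N ->
  (forall i, imem s aDigit i = 0%N) ->
  runs fill_rows s (N * (k * 80 + 50) + 30) reads_digits.
Proof.
move=> hin hN h0; eapply runs_cost.
- eapply runs_seq, runs_iset.
  apply: (runs_while (I := fun i s' => imem s' aQ 0 = i /\
    forall q j, (q <= i)%N -> (j < k)%N -> imem s' aDigit (q * k + j)%N = digits q j)
    (m := N)).
  + by split=> // q j; rewrite leqn0 => /eqP-> _; exact: h0.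
  + move=> q s1 qN fr [hQ hD]; have hin1 := frame_input fr isT hin.
    have hN1 : imem s1 aN 0 = N := etrans (fr.1 aN isT 0%N) hN.
    split; first by rewrite /= hQ hN1 addn1.
    eapply runs_seq, runs_iset, runs_seq, runs_iset, runs_then.
    * apply: (runs_while (I := fun j s' => [/\ imem s' aJ 0 = j,
        carries q j (imem s' aC 0),
        forall q' j', (q' <= q)%N -> (j' < k)%N ->
          imem s' aDigit (q' * k + j')%N = digits q' j'
        & forall j', (j' < j)%N -> imem s' aDigit (q.+1 * k + j')%N = digits q.+1 j'])
        (m := k)).
      (* The radix at position 0 is 1, so an increment is a carry of 1 into that position. *)
      - split=> //; rewrite /carries /upd /=; case: (q) => // q'.
        by rewrite /radix big_geq // !divn1 addn1.
      - move=> j s2 jk fr2 [hJ hC hD2 hD2']; have [h1 h2 _ _] := frame_input fr2 isT hin1.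
        have hQ2 : imem s2 aQ 0 = q by rewrite (fr2.1 aQ isT).
        split; first by rewrite /= hJ h1 addn1.
        have := digit_carry jk hC; rewrite -hD2 //.
        set d := imem s2 aDigit _ => hd.
        have dE : ieval s2 (dig aQ) = d by rewrite /= hJ hQ2 h1.
        have addrE : ieval s2 (cell (IAdd (var aQ) (IConst 1))) = (q.+1 * k + j)%N.
          by rewrite /= hJ hQ2 h1 addn1.
        have addrN q' j' : (q' <= q)%N -> (j' < k)%N ->
            (q' * k + j' == q.+1 * k + j)%N = false.
          by move=> qq' jk'; rewrite cell_inj // ltn_eqF.
        have addrN' j' : (j' < j)%N -> (q.+1 * k + j' == q.+1 * k + j)%N = false.
          by move=> jj'; rewrite eqn_add2l ltn_eqF.
        have condE : beval s2 (BILe (IAdd (dig aQ) (var aC)) len_j)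
            = (d + imem s2 aC 0 <= len x j)%N.
          by rewrite /= -/(ieval s2 (dig aQ)) hJ hQ2 h1 h2.
        eapply runs_seq, runs_if; rewrite condE => hc.
        + rewrite hc in hd; case: hd => hd1 hd2.
          eapply runs_seq, runs_iset, runs_iset, runs_iset.
          split.
          - by rewrite /upd /= hJ addn1.
          - by rewrite /upd /= !(hJ, hQ2, h1, addn1) addrN //= -/d hd2.
          - by move=> q' j' qq' jk'; rewrite /upd /= !(hJ, hQ2, h1, addn1) addrN // hD2.
          - move=> j'; rewrite ltnS leq_eqVlt /upd /= !(hJ, hQ2, h1, addn1).
            by case/predU1P=> [->|jj]; rewrite ?eqxx ?addrN' ?hD2'.
        + rewrite (negbTE hc) in hd; case: hd => hd1 hd2.
          eapply runs_iset, runs_iset.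
          split.
          - by rewrite /upd /= hJ addn1.
          - exact: hd2.
          - by move=> q' j' qq' jk'; rewrite /upd /= !(hJ, hQ2, h1, addn1) addrN // hD2.
          - move=> j'; rewrite ltnS leq_eqVlt /upd /= !(hJ, hQ2, h1, addn1).
            by case/predU1P=> [->|jj]; rewrite ?eqxx ?addrN' ?hD2'.
      - move=> s2 fr2 [hJ hC hD2 hD2']; have [h1 h2 _ _] := frame_input fr2 isT hin1.
        split; first by rewrite /= hJ h1 addn1 ltnn.
        exact: conj hD2 hD2'.
    * move=> s2 fr2 /= [hD2 hD2']; eapply runs_iset; split.
        by rewrite /upd /= (fr2.1 aQ isT) /upd /= hQ addn1.
      move=> q' j; rewrite leq_eqVlt ltnS => /predU1P[->|qq] jk; first exact: hD2'.
      exact: hD2.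
  + move=> s1 fr [hQ hD]; have hN1 : imem s1 aN 0 = N := etrans (fr.1 aN isT 0%N) hN.
    by split; [rewrite /= hQ hN1 addn1 ltnn|split].
- by rewrite /=; nia.
Qed.

(** * Weighted moments of the blocks *)

Lemma nth_flatten_ser j p : (p < len x j)%N ->
  (flatten x)`_(\sum_(0 <= i < j) len x i + p) = (ser x j)`_p.
Proof.
rewrite /len /ser; elim: (x) j => [|y ys IH] [|j] //=.
  by move=> py; rewrite big_geq // nth_cat py.
by move=> pj; rewrite big_nat_recl //= -addnA nth_cat -ltn_subRL subnn ltn0 addKn IH.
Qed.

(** The rows may be incomparable: as the digits of [q] are positive, the bounds of the inner loop
    agree with [lo] in every case, and the truncated differences summed in [aC] all vanish exactly
    when [e] lies below [q] componentwise. *)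
Lemma moments_runs s e q : reads_input s -> reads_digits s ->
  imem s aE 0 = e -> imem s aQ 0 = q -> (e <= N)%N -> (0 < q <= N)%N ->
  runs moments s (k * (n * 80 + 200) + 100) (fun s' =>
    [/\ qmem s' dM1 0 = moment k x w id (digits e) (digits q),
        qmem s' dM0 0 = moment k x w (fun=> 1) (digits e) (digits q),
        qmem s' dM2 0 = moment k x w (fun r => r * r) (digits e) (digits q)
      & imem s' aC 0 = 0%N <-> row_le k x e q]).
Proof.
move=> hin hdig hE hQ eN /andP[q0 qN]; eapply runs_cost.
- do 3 eapply runs_seq, runs_qset; do 2 eapply runs_seq, runs_iset.
  eapply runs_seq, runs_iset.
  pose I j s' := [/\ imem s' aJ 0 = j /\ imem s' aOff 0 = (\sum_(0 <= i < j) len x i)%N,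
    qmem s' dM1 0 = moment j x w id (digits e) (digits q),
    qmem s' dM0 0 = moment j x w (fun=> 1) (digits e) (digits q),
    qmem s' dM2 0 = moment j x w (fun r => r * r) (digits e) (digits q)
    & imem s' aC 0 = (\sum_(0 <= i < j) (digits e i - digits q i))%N].
  apply: (runs_while (I := I) (m := k)).
  + by rewrite /I /moment !big_geq.
  + move=> j s1 jk fr [[hJ hOff] hM1 hM0 hM2 hC].
    have [h1 h2 h3 h4] := frame_input fr isT hin.
    have [hN hD] := frame_digits fr isT hdig.
    have hE1 : imem s1 aE 0 = e := etrans (fr.1 aE isT 0%N) hE.
    have hQ1 : imem s1 aQ 0 = q := etrans (fr.1 aQ isT 0%N) hQ.
    split; first by rewrite /= hJ h1 addn1.
    set a := digits e j; set b := digits q j.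
    have ha : imem s1 aDigit (e * k + j)%N = a by apply: hD.
    have hb : imem s1 aDigit (q * k + j)%N = b by apply: hD.
    have /andP[b0 bn] : (0 < b <= len x j)%N := digit_bounds len_gt0 jk q0.
    have loE : (a - (a + 1 - b) = lo a b)%N by rewrite /lo; lia.
    (* Partial block sums, with [f] generic so that one recurrence serves all three moments. *)
    pose F (f : rat -> rat) m := \sum_(lo a b <= p < m) w`_j * f (ser x j)`_p.
    eapply (@runs_cost _ _ _ (n * 80 + 150)).
    * do 2 eapply runs_seq, runs_iset; eapply runs_then.
        apply: (runs_while (I := fun i s' => [/\ imem s' aP 0 = (lo a b + i)%N,
          qmem s' dM1 0 = qmem s1 dM1 0 + F id (lo a b + i)%N,
          qmem s' dM0 0 = qmem s1 dM0 0 + F (fun=> 1) (lo a b + i)%N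
          & qmem s' dM2 0 = qmem s1 dM2 0 + F (fun r => r * r) (lo a b + i)%N])
          (m := (b - lo a b)%N)).
        - rewrite /F addn0 !big_geq // !addr0; split=> //.
          by rewrite /upd /= !(hE1, hQ1, hJ, h1) ha hb loE.
        - move=> i s2 ib fr2 [hP2 hM12 hM02 hM22].
          have [k1 k2 k3 k4] := frame_input fr2 isT (frame_input fr isT hin).
          have hQ2 : imem s2 aQ 0 = q := etrans (fr2.1 aQ isT 0%N) hQ1.
          have hJ2 : imem s2 aJ 0 = j := etrans (fr2.1 aJ isT 0%N) hJ.
          have hO2 : imem s2 aOff 0 = (\sum_(0 <= i < j) len x i)%N :=
            etrans (fr2.1 aOff isT 0%N) hOff.
          have hb2 : imem s2 aDigit (q * k + j)%N = b :=
            etrans (fr2.1 aDigit isT _) hb.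
          have ib' : (lo a b + i < b)%N by lia.
          split; first by rewrite /= !(hQ2, hJ2, k1) hb2 hP2; lia.
          have FS f : F f (lo a b + i.+1)%N
              = F f (lo a b + i)%N + w`_j * f (ser x j)`_(lo a b + i).
            by rewrite addnS /F big_nat_recr ?leq_addr.
          do 3 eapply runs_seq, runs_qset; eapply runs_iset; rewrite !FS !addrA.
          rewrite -hM12 -hM02 -hM22 -[(ser x j)`_ _]nth_flatten_ser; last exact: leq_trans bn.
          by rewrite /upd /= !(hJ2, hO2, hP2, k3, k4) addn1 addnS mulr1.
        - move=> s2 fr2 [hP2 hM12 hM02 hM22].
          have [k1 k2 k3 k4] := frame_input fr2 isT (frame_input fr isT hin).
          have hQ2 : imem s2 aQ 0 = q := etrans (fr2.1 aQ isT 0%N) hQ1.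
          have hJ2 : imem s2 aJ 0 = j := etrans (fr2.1 aJ isT 0%N) hJ.
          have hb2 : imem s2 aDigit (q * k + j)%N = b :=
            etrans (fr2.1 aDigit isT _) hb.
          have lob : (lo a b + (b - lo a b) = b)%N by rewrite subnKC // /lo; lia.
          rewrite lob in hP2 hM12 hM02 hM22; split; last exact: And3 hM12 hM02 hM22.
          by rewrite /= !(hQ2, hJ2, k1) hb2 hP2 addn1 ltnn.
      move=> s2 fr2 /= [hM12 hM02 hM22]; eapply runs_seq, runs_iset, runs_iset.
      have [k1 k2 k3 k4] := frame_input fr2 isT (frame_input fr isT hin).
      have hJ2 : imem s2 aJ 0 = j := etrans (fr2.1 aJ isT 0%N) hJ.
      have hO2 : imem s2 aOff 0 = (\sum_(0 <= i < j) len x i)%N :=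
        etrans (fr2.1 aOff isT 0%N) hOff.
      rewrite /I !momentS !big_nat_recr //= -hM1 -hM0 -hM2.
      split=> //.
      - by rewrite /upd /= !(hJ2, hO2, k2) addn1.
      - by rewrite /upd /= (fr2.1 aC isT) /upd /= !(hE1, hQ1, hJ, h1) ha hb hC.
    * have : (b - lo a b <= n)%N by rewrite (leq_trans (leq_subr _ _)) ?(leq_trans bn).
      rewrite /=; nia.
  + move=> s1 fr [[hJ hOff] hM1 hM0 hM2 hC].
    have [h1 _ _ _] := frame_input fr isT hin.
    split; first by rewrite /= hJ h1 addn1 ltnn.
    split=> //; rewrite hC big_mkord; split=> [/eqP|hle].
      rewrite sum_nat_eq0 => /forallP h j jk; have := h (Ordinal jk).
      by rewrite /= subn_eq0.
    by apply/eqP; rewrite sum_nat_eq0; apply/forallP => -[j jk]; rewrite /= subn_eq0 hle.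
- by rewrite /=; nia.
Qed.

(** * The backward table of optimal costs *)

Lemma row_le_max e : (e <= N)%N -> row_le k x e N.
Proof.
move=> eN j jk; rewrite (digit_max len_gt0 jk); case: e eN => // e _.
by have /andP[] := digit_bounds len_gt0 jk (ltn0Sn e).
Qed.

(* The tables are correct at row [e] as far as the successors above [q0] go. *)
Definition table_row (s : store) (e q0 : nat) : Prop :=
  let D := qmem s dD in let nxt := imem s aNext e in
  [/\ (e < nxt <= N)%N, row_le k x e nxt,
      D e = D nxt + step_cost k x w (digits e) (digits nxt),
      qmem s dMean e = step_mean k x w (digits e) (digits nxt)
    & forall q, (q0 < q <= N)%N -> row_le k x e q ->
        D e <= D q + step_cost k x w (digits e) (digits q)].

Lemma eq_table_row s s' e q0 : (e <= q0)%N ->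
  (forall q, (e <= q)%N -> qmem s' dD q = qmem s dD q) ->
  imem s' aNext e = imem s aNext e -> qmem s' dMean e = qmem s dMean e ->
  table_row s e q0 -> table_row s' e q0.
Proof.
move=> eq0 hD hn hm [h1 h2 h3 h4 h5]; split; rewrite ?hn ?hm ?hD //.
  by have /andP[/ltnW] := h1.
move=> q /[dup] /h5 h /andP[q0q _] /h; rewrite hD //.
by rewrite (leq_trans eq0) // ltnW.
Qed.

(** One step of a running minimum: the bound moves from [q] to [q.-1] because [q] itself is now
    taken into account. A replacement lowers the value, so the inequalities for earlier successors
    survive. *)
Lemma relax_runs s e q : imem s aN 0 = N -> imem s aE 0 = e -> imem s aQ 0 = q ->
  (e < q <= N)%N ->
  [/\ qmem s dM1 0 = moment k x w id (digits e) (digits q),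
      qmem s dM0 0 = moment k x w (fun=> 1) (digits e) (digits q),
      qmem s dM2 0 = moment k x w (fun r => r * r) (digits e) (digits q)
    & imem s aC 0 = 0%N <-> row_le k x e q] ->
  ((q < N)%N -> table_row s e q) ->
  runs relax s 100 (fun s' => table_row s' e q.-1 /\ forall e', e' != e ->
    [/\ qmem s' dD e' = qmem s dD e', imem s' aNext e' = imem s aNext e'
      & qmem s' dMean e' = qmem s dMean e']).
Proof.
move=> hN hE hQ /andP[eq qN] [hM1 hM0 hM2 hC] hT.
pose cand := qmem s dD q + step_cost k x w (digits e) (digits q).
have candE s' : qmem s' dD q = qmem s dD q -> imem s' aQ 0 = q ->
    qmem s' dM1 = qmem s dM1 -> qmem s' dM0 = qmem s dM0 ->
    qmem s' dM2 = qmem s dM2 -> qeval s' candidate = cand.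
  by move=> /= h -> -> -> ->; rewrite h hM1 hM0 hM2.
have condE : beval s (BAnd (BILe (var aC) (IConst 0))
    (BNot (BAnd (ilt (var aQ) (var aN)) (BQLe (QGet dD (var aE)) candidate))))
    = (imem s aC 0 == 0%N) && ~~ ((q < N)%N && (qmem s dD e <= cand)).
  rewrite -(candE s) //; cbn [beval ieval ilt var]; rewrite hN hQ addn1 leqn0.
  by cbn [qeval ieval var]; rewrite hE.
have above q' : (q.-1 < q' <= N)%N -> q' = q \/ (q < q' <= N)%N by lia.
eapply runs_cost.
- apply: runs_if; rewrite condE.
  + move=> /andP[/eqP /hC hle hmin].
    eapply runs_seq, runs_qset, runs_seq, runs_qset, runs_iset.
    rewrite candE //; split; last first.
      by move=> e' /negbTE e'e; rewrite /upd /= !(hE, hQ) e'e.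
    rewrite /table_row /upd /= !(hE, hQ, eqxx) /= hM1 hM0 (gtn_eqF eq).
    split=> //; first by rewrite eq.
    move=> q' /[dup] q'N /above[-> _|/andP[qq' q'N'] hle']; first by rewrite gtn_eqF.
    rewrite gtn_eqF ?(ltn_trans eq) //.
    have qN' : (q < N)%N by apply: leq_trans q'N'.
    have [_ _ _ _ /(_ q')] := hT qN'; rewrite qq' q'N' => /(_ isT hle').
    by apply: le_trans; move: hmin; rewrite qN' /= -ltNge => /ltW.
  + move=> hcond; apply: runs_skip; split=> //.
    (* The last row lies above every row, so [q = N] is never rejected; hence an earlier choice
       exists. *)
    have qN' : (q < N)%N.
      rewrite ltn_neqAle qN andbT; apply: contra hcond => /eqP qE.
      rewrite qE ltnn /= andbT; apply/eqP/hC; rewrite qE.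
      by apply: row_le_max; rewrite -qE ltnW.
    have [h1 h2 h3 h4 h5] := hT qN'; split=> // q' /above[->|/h5 //] /hC hc.
    by move: hcond; rewrite hc eqxx qN' /= negbK.
- by [].
Qed.

Definition table_above (s : store) (e : nat) : Prop :=
  qmem s dD N = 0 /\ forall e', (e < e' < N)%N -> table_row s e' e'.

Lemma eq_table_above s s' e :
  (forall e', (e < e')%N -> [/\ qmem s' dD e' = qmem s dD e',
     imem s' aNext e' = imem s aNext e' & qmem s' dMean e' = qmem s dMean e']) ->
  (e < N)%N -> table_above s e -> table_above s' e.
Proof.
move=> h eN [h0 ht]; split=> [|e' /[dup] /andP[ee' _] /ht]; first by have [-> ] := h _ eN.
have [_ hn hm] := h _ ee'.
by apply: eq_table_row => // q e'q; have [] := h _ (leq_trans ee' e'q).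
Qed.

Lemma scan_runs s e : reads_input s -> reads_digits s -> (e < N)%N ->
  imem s aE 0 = e -> imem s aQ 0 = N -> table_above s e ->
  runs (CWhile (ilt (var aE) (var aQ)) scan_body) s
    (N * (k * (n * 80 + 200) + 230) + 30)
    (fun s' => table_above s' e /\ table_row s' e e).
Proof.
move=> hin hdig eN hE hQ hT; eapply runs_cost.
(* Before the first round row [e] holds nothing useful, hence the guard [0 < i]. *)
- apply: (runs_while (I := fun i s' => [/\ imem s' aQ 0 = (N - i)%N, table_above s' e
      & (0 < i)%N -> table_row s' e (N - i)]) (m := (N - e)%N)).
  + by rewrite subn0.
  + move=> i s1 ie fr [hQ1 hT1 hrow].
    have hin1 := frame_input fr isT hin; have hdig1 := frame_digits fr isT hdig.
    have hE1 : imem s1 aE 0 = e := etrans (fr.1 aE isT 0%N) hE.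
    have eq : (e < N - i)%N by lia.
    split; first by rewrite /= hE1 hQ1 addn1.
    eapply runs_then.
      apply: moments_runs hin1 hdig1 hE1 hQ1 (ltnW eN) _.
      by rewrite leq_subr (leq_ltn_trans _ eq).
    move=> s2 fr2 hM; eapply runs_then.
      apply: relax_runs hM _.
      - exact: etrans (fr2.1 aN isT 0%N) hdig1.1.
      - exact: etrans (fr2.1 aE isT 0%N) hE1.
      - exact: etrans (fr2.1 aQ isT 0%N) hQ1.
      - by rewrite eq leq_subr.
      - move=> qN; have i0 : (0 < i)%N by lia.
        apply: eq_table_row (hrow i0); first exact: ltnW.
        + by move=> q' _; rewrite (fr2.2 dD isT).
        + by rewrite (fr2.1 aNext isT).
        + by rewrite (fr2.2 dMean isT).
    move=> s3 fr3 [hrow3 hoth]; eapply runs_iset; split.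
    * have hQ3 : imem s3 aQ 0 = (N - i)%N.
        by rewrite (fr3.1 aQ isT) (fr2.1 aQ isT).
      by rewrite /upd /= hQ3 subn1 subnS.
    * apply: eq_table_above hT1 => // e' ee'; have [|h1 h2 h3] := hoth e'.
        by rewrite gtn_eqF.
      by rewrite /upd /= h1 h2 h3 (fr2.1 aNext isT) (fr2.2 dMean isT) (fr2.2 dD isT).
    * by move=> _; rewrite subnS.
  + move=> s1 fr [hQ1 hT1 hrow].
    have hE1 : imem s1 aE 0 = e := etrans (fr.1 aE isT 0%N) hE.
    have NE : (N - (N - e) = e)%N by lia.
    rewrite NE in hQ1 hrow; rewrite /= hE1 hQ1 addn1 ltnn; split=> //; split=> //.
    by apply: hrow; lia.
- have : (N - e <= N)%N by exact: leq_subr.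
  by rewrite /=; nia.
Qed.

(** Rows are settled from [N.-1] downwards, so each scan reads only final values of its successors.
    Row [N] is never written, and its initial 0 becomes [dp_last]. *)
Lemma solve_runs s : reads_input s -> reads_digits s -> qmem s dD N = 0 ->
  runs solve s (N * (N * (k * (n * 80 + 200) + 230) + 70) + 30)
    (fun s' => dp_solution k x w (qmem s' dD) (imem s' aNext) (qmem s' dMean)).
Proof.
move=> hin hdig h0; eapply runs_cost.
- eapply runs_seq, runs_iset.
  apply: (runs_while (I := fun i s' => [/\ imem s' aE 0 = (N - i)%N, qmem s' dD N = 0
    & forall e, (N - i <= e < N)%N -> table_row s' e e]) (m := N)).
  + split=> //; first by rewrite subn0; exact: hdig.1.
    by move=> e; lia.
  + move=> i s1 iN fr [hE hD hT].
    have hin1 := frame_input fr isT hin; have hdig1 := frame_digits fr isT hdig.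
    split; first by rewrite /= hE subn_gt0.
    eapply runs_seq, runs_iset, runs_seq, runs_iset; eapply runs_weaken.
    * apply: (@scan_runs _ (N - i.+1)).
      - exact: hin1.
      - exact: hdig1.
      - by lia.
      - by rewrite /upd /= hE subn1 subnS.
      - exact: hdig1.1.
      - by split=> // e he; apply: hT; lia.
    * exact: leqnn.
    * move=> s2 fr2 [[hD2 hT2] hrow]; split=> //.
        by rewrite (fr2.1 aE isT) /upd /= hE subn1 subnS.
      move=> e /andP[]; rewrite leq_eqVlt => /predU1P[<- //|ee eN].
      by apply: hT2; rewrite ee.
  + move=> s1 fr [hE hD hT]; rewrite subnn in hE hT; split; first by rewrite /= hE.
    split=> // [e eN|e q /andP[eq qN] hle].
      by have [] := hT e eN.
    have eN : (0 <= e < N)%N by apply: leq_trans qN.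
    by have [_ _ _ _ h] := hT e eN; apply: h; rewrite // eq.
- by rewrite /=; nia.
Qed.

(** * Reading off the mean *)

Lemma dp_chain (nxt : nat -> nat) (u := fun t => iter t nxt 0%N) :
  (forall e, (e < N)%N -> (e < nxt e <= N)%N) ->
  exists m, [/\ (m <= N)%N, u m = N & forall t, (t < m)%N -> (u t < N)%N].
Proof.
move=> hn.
have ule t : (u t <= N)%N -> (u t.+1 <= N)%N \/ u t = N.
  by rewrite leq_eqVlt => /predU1P[->|/hn /andP[_ h]]; [right|left].
(* The chain increases strictly until it reaches [N], so [t <= u t]; this bounds its length by
   [N]. *)
have ugrow t : (forall t', (t' < t)%N -> (u t' < N)%N) -> (t <= u t <= N)%N.
  elim: t => // t IH h; have /andP[tu _] := IH (fun t' tt' => h t' (ltnW tt')).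
  have /andP[h1 h2] := hn _ (h _ (ltnSn t)).
  by rewrite -[u t.+1]/(nxt (u t)) h2 (leq_ltn_trans tu).
have ex : exists t, (N <= u t)%N.
  case: (pickP (fun t : 'I_N.+1 => (N <= u t)%N)) => [t ht|h]; first by exists t.
  have lt t : (t < N.+1)%N -> (u t < N)%N.
    by move=> tN; have := h (Ordinal tN); rewrite /= ltnNge => ->.
  by exists N; have /andP[] := ugrow N (fun t tN => lt t (ltnW tN)).
case: (ex_minnP ex) => m um minm; exists m.
have lt t : (t < m)%N -> (u t < N)%N.
  by move=> tm; rewrite ltnNge; apply: contraL tm => /minm; rewrite -leqNgt.
have /andP[mu uN] := ugrow m lt.
by split=> //; [exact: leq_trans uN|apply/eqP; rewrite eqn_leq uN].
Qed.

Lemma emit_runs s m (u := fun t => iter t (imem s aNext) 0%N) :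
  imem s aN 0 = N -> imem s aOut 0 = 0%N ->
  (m <= N)%N -> u m = N -> (forall t, (t < m)%N -> (u t < N)%N) ->
  runs emit s (N * 40 + 30)
    (fun s' => output s' = mkseq (fun t => qmem s dMean (u t)) m).
Proof.
move=> hN hO mN um ut; eapply runs_cost.
- eapply runs_seq, runs_iset.
  apply: (runs_while (I := fun i s' => [/\ imem s' aCur 0 = u i, imem s' aOut 0 = i
    & forall t, (t < i)%N -> qmem s' dOut t = qmem s dMean (u t)]) (m := m)).
  + by [].
  + move=> i s1 im fr [hC hO1 hD].
    have hN1 : imem s1 aN 0 = N := etrans (fr.1 aN isT 0%N) hN.
    split; first by rewrite /= hC hN1 addn1 ut.
    eapply runs_seq, runs_qset, runs_seq, runs_iset, runs_iset; split.
    * by rewrite /upd /= hC (fr.1 aNext isT).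
    * by rewrite /upd /= hO1 addn1.
    * move=> t; rewrite ltnS leq_eqVlt /upd /= hO1 => /predU1P[->|ti].
        by rewrite eqxx hC (fr.2 dMean isT).
      by rewrite ltn_eqF // hD.
  + move=> s1 fr [hC hO1 hD].
    have hN1 : imem s1 aN 0 = N := etrans (fr.1 aN isT 0%N) hN.
    split; first by rewrite /= hC hN1 um addn1 ltnn.
    rewrite /output hO1; apply/eq_in_map => t; rewrite mem_iota => /andP[_ tm].
    exact: hD.
- by rewrite /=; nia.
Qed.

End Correctness.

(** * The four phases together and the total cost *)

Theorem theorem2 :
  exists (P : cmd) (K : nat),
  forall (k : nat) (x : k.-tuple (seq rat)) (w : k.-tuple rat),
    (0 < k)%N ->
    (forall i : 'I_k, (0 < size (tnth x i))%N) ->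
    (forall i : 'I_k, 0 <= tnth w i) ->
    let n := (\max_(i < k) size (tnth x i))%N in
    exists (s : store) (t : nat),
      [/\ exec P (input x w) s t,
          (t <= K * (n ^ (2 * k + 1) * 2 ^ k * k))%N
        & forall R : realType, is_weighted_dtw_mean R x w (output s)].
Proof.
(* The constants in the bounds of the four phases add up to 900; 2000 is a round number above
   that. *)
exists dtw_mean_program, 2000%N => k x w k0 x0 w0 n.
have hk : size x = k := size_tuple x.
have lenE (i : 'I_k) : len x i = size (tnth x i).
  by rewrite -size_ser /ser (tnth_nth [::]).
have len_gt0 j : (j < size x)%N -> (0 < len x j)%N.
  by rewrite hk => jk; rewrite -[j]/(val (Ordinal jk)) lenE.
have len_le j : (len x j <= n)%N.
  have [jk|jk] := ltnP j k; last by rewrite /len nth_default // size_map hk.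
  by rewrite -[j]/(val (Ordinal jk)) lenE (leq_bigmax (Ordinal jk)).
pose N := radix (len x) k.
have NE : radix (len x) (size x) = N by rewrite hk.
have N0 : (0 < N)%N by rewrite -NE (radix_gt0 len_gt0).
have N_le : (N <= n ^ k)%N.
  suff h j : (radix (len x) j <= n ^ j)%N by exact: h.
  elim: j => [|j IH]; first by rewrite /radix big_geq.
  by rewrite radixS expnSr leq_mul.
have n0 : (0 < n)%N by apply: leq_trans (len_le 0%N); apply: len_gt0; rewrite hk.
have [s [t [hexec ht hout]]] : runs dtw_mean_program (input x w)
    (2000 * (N * N * n * k)) (fun s => forall R, is_weighted_dtw_mean R x w (output s)).
  have hin : reads_input x w (input x w) by split=> //=; rewrite hk.
  eapply runs_cost.
  - eapply runs_then; first exact: count_rows_runs hin.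
    move=> s1 fr1 hN1; have hin1 := frame_input fr1 isT hin.
    eapply runs_then.
      apply: fill_rows_runs hin1 hN1 _ => //.
      by move=> i; rewrite (fr1.1 aDigit isT).
    move=> s2 fr2 hdig2; have hin2 := frame_input fr2 isT hin1.
    eapply runs_then.
      apply: (solve_runs (n := n)) hin2 hdig2 _ => //.
      by rewrite (fr2.2 dD isT) (fr1.2 dD isT).
    move=> s3 fr3 hsol; have hN3 := etrans (fr3.1 aN isT 0%N) hdig2.1.
    have hO3 : imem s3 aOut 0 = 0%N.
      by rewrite (fr3.1 aOut isT) (fr2.1 aOut isT) (fr1.1 aOut isT).
    have [|m [mN um ut]] := @dp_chain x (imem s3 aNext).
      by move=> e /(dp_next hsol)[].
    eapply runs_weaken; first exact: emit_runs hN3 hO3 mN um ut.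
      exact: leqnn.
    move=> s4 _ -> R; rewrite hk in hsol um ut.
    exact: dp_optimal hsol um ut.
  (* Since [N], [n] and [k] are positive, each monomial in the four bounds is at most
     [N * N * (n * k)]. *)
  - have NN : (N <= N * N)%N by exact: leq_pmull.
    have kn : (k <= n * k)%N by exact: leq_pmull.
    have nk0 : (0 < n * k)%N by rewrite muln_gt0 n0.
    have b1 : (N * N <= N * N * (n * k))%N by exact: leq_pmulr.
    have b2 : (N * N * k <= N * N * (n * k))%N by rewrite leq_mul2l kn orbT.
    have b3 : (N * k <= N * N * k)%N by rewrite leq_mul2r NN orbT.
    have b4 : (k <= N * k)%N by exact: leq_pmull.
    rewrite /= NE hk; nia.
exists s, t; split=> //; apply: leq_trans ht _.
(* The bound [N * N * n * k] is at most [n ^ (2 * k + 1) * k] by [N_le], and multiplying by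
   [2 ^ k >= 1] only enlarges it. *)
have h2 : (0 < 2 ^ k)%N by rewrite expn_gt0.
rewrite leq_mul2l /= leq_mul2r; apply/orP; right.
rewrite -[(_ * n)%N]muln1 leq_mul // addn1 expnSr leq_mul // mul2n -addnn expnD.
exact: leq_mul.
Qed.
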